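(* For $1\le n\le 20$, the set of positive integers $\ell$ with $\Delta_\ell(n)<0$ is exactly: $n=1$: $\ell\ge 2$; $n=2$: empty; $n=3$: $2\le\ell\le 13$; $n=4$: $\ell\ge 16$; $n=5$: $2\le \ell\le 19$; $n=6$: empty; $n=7$: $\ell\ge 2$; $n=8$: $15\le\ell\le 26$; $n=9$: $2\le\ell\le 12$; $n=10$: $\ell\ge 22$; $n=11$: $2\le\ell\le 35$; $n=12$: empty; $n=13$: $2\le\ell\le 9$ or $\ell\ge 26$; $n=14$: $20\le\ell\le 44$; $n=15$: $2\le\ell\le 8$; $n=16$: $\ell\ge 29$; $n=17$: $2\le\ell\le 6$ or $24\le\ell\le 54$; $n=18$: empty; $n=19$: $2\le\ell\le 4$ or $\ell\ge 32$; $n=20$: $\ell\ge 27$.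
   Context: For integers $n\geq 0$ let $S_n$ be the symmetric group on $n$ elements ($S_0$ trivial). For an integer $\ell\geq 1$ let $C_{\ell,n}=\{(\pi_1,\dots,\pi_\ell)\in S_n^\ell : \pi_j\pi_k=\pi_k\pi_j \text{ for all } 1\le j,k\le \ell\}$ and $N_\ell(n)=|C_{\ell,n}|/|S_n|$ (so $N_\ell(0)=1$). Define $\Delta_\ell(n)=N_\ell(n)^2-N_\ell(n-1)N_\ell(n+1)$ for $n\geq 1$; a pair $(n,\ell)$ with $\Delta_\ell(n)<0$ is called an exception. *)

(* Defs.v *)
From HB Require Import structures.
From mathcomp Require Import all_boot all_order all_algebra all_fingroup.
Set Implicit Arguments. Unset Strict Implicit. Unset Printing Implicit Defensive.
Import Order.TTheory GRing.Theory Num.Theory.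

Definition commuting_tuples (l n : nat) : {set {ffun 'I_l -> {perm 'I_n}}} :=
  [set pi : {ffun 'I_l -> {perm 'I_n}} |
     [forall j : 'I_l, forall k : 'I_l, (pi j * pi k == pi k * pi j)%g]].

Definition Nl (l n : nat) : rat :=
  (#|commuting_tuples l n|%:R / #|{perm 'I_n}|%:R)%R.

Definition Delta (l n : nat) : rat :=
  (Nl l n ^+ 2 - Nl l n.-1 * Nl l n.+1)%R.

(* Main.v *)
(* Let [c_l(n)] be the number of commuting [l]-tuples of permutations of [n] points and [a_l(k)] the
   number of subgroups of index [k] in [Z^l].  Splitting off the orbit of a point, and noting that a
   transitive tuple on [k] pointed labels amounts to such a subgroup with one of [(k-1)!] labellings,
   gives [c_l(n+1) = sum_k n(n-1)...(n-k+1) a_l(k+1) c_l(n-k)].  For a transitive tuple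
   [(g, t_1, ..., t_l)], the orbits of [t] have a common size [d] dividing [k], they are permuted
   cyclically by [g], and [g^(k/d)] acts on the first one as one of the [d] elements of the regular
   group generated by [t]; hence [a_(l+1)(k) = sum_(d | k) d a_l(d)].

   For [l < 60] the signs are read off from enclosures of the [c_l(n)].  For fixed [k], [a_l(k)] is a
   combination of the [d^l] with [d | k], so [c_l(n)] is an exponential polynomial in [l]; its
   largest base is about [3^(n/3)].  Keeping the few leading terms and bounding the others decides
   the sign for all [l >= 60] at once; for [n = 20] the leading terms cancel and the next ones
   decide. *)
From Stdlib Require Import ZArith Lia.
Require Import Defs.
From mathcomp Require Import all_boot all_order all_algebra all_fingroup.
From mathcomp Require Import cyclic ring.
Set Implicit Arguments. Unset Strict Implicit. Unset Printing Implicit Defensive.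
Import Order.TTheory GRing.Theory Num.Theory.

(** * Splitting off an orbit *)

Local Open Scope group_scope.

Section Tuples.
Variables (T : finType) (l : nat).
Implicit Types (t : {ffun 'I_l -> {perm T}}) (x : T) (D : {set T}).

(** Over an arbitrary finite type, so that sum and product types can serve as label sets; for
    [T := 'I_n] it is convertible to [commuting_tuples]. *)
Definition ctuples : {set {ffun 'I_l -> {perm T}}} :=
  [set t : {ffun 'I_l -> {perm T}} |
     [forall j : 'I_l, forall k : 'I_l, t j * t k == t k * t j]].

Definition gentuple t : {group {perm T}} := <<[set t i | i : 'I_l]>>%G.

Definition orb t x : {set T} := orbit 'P (gentuple t) x.

Definition ttuples x := [set t in ctuples | orb t x == setT].

Lemma ctuplesP t : reflect (forall i j, commute (t i) (t j)) (t \in ctuples).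
Proof.
rewrite inE; apply: (iffP forallP) => [H i j|H i]; last by apply/forallP=> j; apply/eqP/H.
by move/forallP: (H i) => /(_ j)/eqP.
Qed.

Lemma mem_gentuple t i : t i \in gentuple t.
Proof. by rewrite mem_gen ?imset_f. Qed.

Lemma ctuples_abelian t : t \in ctuples -> abelian (gentuple t).
Proof.
move/ctuplesP=> ct; rewrite /= abelian_gen; apply/centsP=> _ /imsetP[i _ ->] _ /imsetP[j _ ->].
exact: ct.
Qed.

Lemma cent_gentuple t (q : {perm T}) :
  (forall i, commute q (t i)) -> forall a, a \in gentuple t -> commute q a.
Proof.
move=> H a; suff: gentuple t \subset 'C[q] by move/subsetP => s /s /cent1P /commute_sym.
by rewrite gen_subG; apply/subsetP=> _ /imsetP[i _ ->]; apply/cent1P/commute_sym.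
Qed.

Lemma orb_refl t x : x \in orb t x. Proof. exact: orbit_refl. Qed.

Lemma orb_closed t x i y : y \in orb t x -> t i y \in orb t x.
Proof.
case/orbitP=> a aG <-; apply/orbitP; exists (a * t i); first by rewrite groupM ?mem_gentuple.
by rewrite /= /aperm permM.
Qed.

Lemma orb_min t x D :
  x \in D -> (forall i y, y \in D -> t i y \in D) -> orb t x \subset D.
Proof.
move=> xD cl; suff sN : gentuple t \subset 'N(D | 'P).
  by rewrite /orb acts_sub_orbit.
rewrite gen_subG; apply/subsetP=> _ /imsetP[i _ ->].
by rewrite inE; apply/andP; split=> //; rewrite inE; apply/subsetP=> y yD; rewrite inE; apply: cl.
Qed.

(** The centraliser of a transitive group acts freely: commuting with the group carries the
    agreement at [x] to every point of its orbit. *)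
Lemma transitive_commute_inj t x (q q' : {perm T}) :
    orb t x = setT -> (forall i, commute q (t i)) -> (forall i, commute q' (t i)) ->
  q x = q' x -> q = q'.
Proof.
move=> ot cq cq' e; apply/permP=> y; have: y \in orb t x by rewrite ot inE.
case/orbitP=> a aG <-; rewrite /= /aperm -!permM.
by rewrite -(cent_gentuple cq aG) -(cent_gentuple cq' aG) !permM e.
Qed.

End Tuples.

Lemma orb_equivariant (T T' : finType) l (f : T' -> T)
    (s : {ffun 'I_l -> {perm T'}}) (t : {ffun 'I_l -> {perm T}}) x :
  (forall i y, t i (f y) = f (s i y)) -> orb t (f x) = f @: orb s x.
Proof.
move=> H; apply/eqP; rewrite eqEsubset; apply/andP; split.
  apply: orb_min; first by rewrite imset_f ?orb_refl.
  by move=> i _ /imsetP[y yo ->]; rewrite H imset_f ?orb_closed.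
rewrite sub_imset_pre; apply: orb_min; first by rewrite inE orb_refl.
by move=> i y; rewrite !inE -H; apply: orb_closed.
Qed.

(** On a finite type the induced injective self-map is already a permutation, so [p] need only map
    the image of [f] into itself. *)
Lemma perm_restrict (T T' : finType) (f : T' -> T) (p : {perm T}) :
    injective f -> (forall x, p (f x) \in codom f) ->
  exists q : {perm T'}, forall x, p (f x) = f (q x).
Proof.
move=> fi H; have qi : injective (fun x => iinv (H x)).
  by move=> x y e; apply/fi/(@perm_inj _ p); rewrite -(f_iinv (H x)) e f_iinv.
by exists (perm qi) => x; rewrite permE f_iinv.
Qed.

(** Enumerating each subset first and its complement afterwards matches the subsets; a transposition
    of two points of [A] then corrects the image of [x']. *)
Lemma exists_pointed_bijection (T T' : finType) (A : {set T}) (A' : {set T'}) x x' :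
    #|T| = #|T'| -> #|A| = #|A'| -> x \in A -> x' \in A' ->
  exists f : T' -> T, [/\ bijective f, f x' = x & f @: A' = A].
Proof.
move=> cT cA xA xA'.
pose s := enum A ++ enum (~: A); pose s' := enum A' ++ enum (~: A').
have us : uniq s by rewrite cat_uniq !enum_uniq andbT /=; apply/hasPn=> y; rewrite !mem_enum inE.
have us' : uniq s' by rewrite cat_uniq !enum_uniq andbT /=; apply/hasPn=> y; rewrite !mem_enum inE.
have ss : size s = #|T| by rewrite size_cat -!cardE cardsC.
have ss' : size s' = #|T'| by rewrite size_cat -!cardE cardsC.
have ms' y : y \in s' by rewrite mem_cat !mem_enum inE orbN.
pose f0 y := nth x s (index y s').
have lt y : index y s' < size s by rewrite ss cT -ss' index_mem.
have fi : injective f0.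
  move=> y z /eqP; rewrite nth_uniq // => /eqP e.
  by rewrite -(nth_index x' (ms' y)) e nth_index.
have fA y : y \in A' -> f0 y \in A.
  move=> yA; rewrite /f0 /s nth_cat /s' index_cat mem_enum yA.
  rewrite -cardE cA cardE index_mem mem_enum yA -mem_enum mem_nth //.
  by rewrite -cardE cA cardE index_mem mem_enum.
pose f := tperm (f0 x') x \o f0.
have fi' : injective f by move=> y z /perm_inj /fi.
have fA' y : y \in A' -> f y \in A.
  by move=> yA; rewrite /f /=; case: tpermP => [_|_|_ _]; rewrite ?xA ?fA.
exists f; split; first by apply: inj_card_bij fi' _; rewrite cT.
  by rewrite /f /= tpermL.
apply/eqP; rewrite eqEcard card_imset // cA leqnn andbT.
by apply/subsetP=> _ /imsetP[y yA ->]; apply: fA'.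
Qed.

(** * Transport of tuples along a bijection of the labels *)

Section Transport.
Variables (T T' : finType) (f : T' -> T) (g : T -> T') (fK : cancel f g) (gK : cancel g f).
Variable l : nat.

Definition relabel (p : {perm T'}) : {perm T} :=
  perm (inj_comp (can_inj fK) (inj_comp (@perm_inj _ p) (can_inj gK))).

Lemma relabelE p x : relabel p (f x) = f (p x).
Proof. by rewrite permE /= fK. Qed.

Definition relabel_tuple (t : {ffun 'I_l -> {perm T'}}) : {ffun 'I_l -> {perm T}} :=
  [ffun i => relabel (t i)].

Lemma relabel_tupleE t i x : relabel_tuple t i (f x) = f (t i x).
Proof. by rewrite ffunE relabelE. Qed.

Lemma relabel_ctuples t : (relabel_tuple t \in ctuples T l) = (t \in ctuples T' l).
Proof.
apply/ctuplesP/ctuplesP=> H i j; apply/permP=> x.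
  move/permP: (H i j) => /(_ (f x)); rewrite !permM !relabel_tupleE.
  exact: (can_inj fK).
by rewrite -(gK x) !permM !relabel_tupleE -!permM H.
Qed.

Lemma relabel_orb t x : orb (relabel_tuple t) (f x) = f @: orb t x.
Proof. by apply: orb_equivariant => i y; apply: relabel_tupleE. Qed.

Lemma relabel_tuple_inj : injective relabel_tuple.
Proof.
move=> t t' e; apply/ffunP=> i; apply/permP=> x; apply: (can_inj fK).
by rewrite -!relabel_tupleE e.
Qed.

Lemma relabel_tuple_surj t : exists t', t = relabel_tuple t'.
Proof.
have H i : exists q : {perm T'}, forall x, t i (f x) = f (q x).
  by apply: perm_restrict => [|x]; [exact: can_inj fK | rewrite -(gK (t i _)) codom_f].
have [q qE] := fin_all_exists H.
exists (finfun q); apply/ffunP=> i; apply/permP=> x.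
by rewrite -(gK x) relabel_tupleE qE ffunE.
Qed.

Lemma card_relabel (P : pred {ffun 'I_l -> {perm T}}) :
  #|[set t | P t]| = #|[set t | P (relabel_tuple t)]|.
Proof.
rewrite -(card_imset _ relabel_tuple_inj); apply: eq_card => t; rewrite inE.
apply/idP/imsetP => [Pt|[t' + ->]]; last by rewrite inE.
by have [t' e] := relabel_tuple_surj t; exists t'; rewrite // inE -e.
Qed.

End Transport.

(** * Tuples preserving a decomposition of the labels *)

Section Split.
Variables (T1 T2 : finType) (l : nat) (x1 : T1).

Definition perm_sum_fun (p : {perm T1}) (q : {perm T2}) (z : T1 + T2) : T1 + T2 :=
  match z with inl x => inl (p x) | inr y => inr (q y) end.

Lemma perm_sum_inj p q : injective (perm_sum_fun p q).
Proof. by move=> [x|y] [x'|y'] //= [] /perm_inj ->. Qed.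

Definition perm_sum p q : {perm T1 + T2} := perm (@perm_sum_inj p q).

(** If the orbit of [inl x1] is the left summand, every component splits into a permutation of each
    summand, and the tuple is a pair of independent tuples. *)
Lemma card_split :
  #|[set t in ctuples (T1 + T2)%type l | orb t (inl x1) == inl @: setT]| =
  (#|ttuples l x1| * #|ctuples T2 l|)%N.
Proof.
pose h (st : {ffun 'I_l -> {perm T1}} * {ffun 'I_l -> {perm T2}}) :=
  [ffun i => perm_sum (st.1 i) (st.2 i)].
have hL st i x : h st i (inl x) = inl (st.1 i x) by rewrite ffunE permE.
have hR st i x : h st i (inr x) = inr (st.2 i x) by rewrite ffunE permE.
have hi : injective h.
  move=> [s t] [s' t'] e; congr pair; apply/ffunP=> i; apply/permP=> x.
    by have := hL (s, t) i x; rewrite e hL => -[].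
  by have := hR (s, t) i x; rewrite e hR => -[].
have horb st : orb (h st) (inl x1) = inl @: orb st.1 x1.
  by apply: orb_equivariant => i y; apply: hL.
have hc st : (h st \in ctuples _ l) = (st.1 \in ctuples _ l) && (st.2 \in ctuples _ l).
  apply/ctuplesP/andP=> [H|[/ctuplesP H1 /ctuplesP H2] i j].
    split; apply/ctuplesP=> i j; apply/permP=> x.
      by move/permP: (H i j) => /(_ (inl x)); rewrite !permM !hL => -[].
    by move/permP: (H i j) => /(_ (inr x)); rewrite !permM !hR => -[].
  apply/permP=> -[x|x]; rewrite !permM ?hL ?hR -!permM; first by rewrite H1.
  by rewrite H2.
rewrite -cardsX -(card_imset _ hi); apply: eq_card => t; rewrite inE.
have inli : injective (@inl T1 T2) by move=> ? ? [].
have inri : injective (@inr T1 T2) by move=> ? ? [].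
apply/andP/imsetP => [[ct /eqP ot]|[st + ->]]; last first.
  case: st => s r /setXP[/setIdP[c1 /eqP o1] c2].
  by rewrite hc horb o1 c1 c2 eqxx.
have pL i x : t i (inl x) \in inl @: [set: T1].
  by rewrite -ot orb_closed // ot imset_f.
have /fin_all_exists[s sE] i : exists q : {perm T1}, forall x, t i (inl x) = inl (q x).
  by apply: perm_restrict => // x; have /imsetP[y _ ->] := pL i x; apply: codom_f.
(* The left summand is already permuted within itself, so injectivity keeps a right point from being
   sent there. *)
have pR i y : t i (inr y) \in codom (@inr T1 T2).
  case e: (t i (inr y)) => [x|z]; last exact: codom_f.
  by move: e; rewrite -[x](permKV (s i)) -sE => /perm_inj.
have /fin_all_exists[r rE] i : exists q : {perm T2}, forall x, t i (inr x) = inr (q x).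
  exact: perm_restrict.
have te : t = h (finfun s, finfun r).
  by apply/ffunP=> i; apply/permP=> -[x|x]; rewrite ?hL ?hR ?sE ?rE ffunE.
exists (finfun s, finfun r) => //.
move: ct ot; rewrite te hc horb => /andP[c1 c2] /(imset_inj inli) e.
by apply/setXP; split=> //; apply/setIdP; rewrite e.
Qed.

End Split.

(** * Transitive commuting tuples *)

Definition ftail (A : Type) l (t : {ffun 'I_l.+1 -> A}) : {ffun 'I_l -> A} :=
  [ffun i => t (lift ord0 i)].

Definition fcons (A : Type) l (a : A) (t : {ffun 'I_l -> A}) : {ffun 'I_l.+1 -> A} :=
  [ffun i => if unlift ord0 i is Some j then t j else a].

Lemma fcons0 A l (a : A) (t : {ffun 'I_l -> A}) : fcons a t ord0 = a.
Proof. by rewrite ffunE unlift_none. Qed.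

Lemma fconsS A l (a : A) (t : {ffun 'I_l -> A}) i : fcons a t (lift ord0 i) = t i.
Proof. by rewrite ffunE liftK. Qed.

Lemma gentuple_cons (T : finType) l (t : {ffun 'I_l.+1 -> {perm T}}) :
  gentuple t = gentuple (ftail t) <*> <[t ord0]> :> {set _}.
Proof.
apply/eqP; rewrite eqEsubset; apply/andP; split.
  rewrite gen_subG; apply/subsetP=> _ /imsetP[i _ ->].
  case: (unliftP ord0 i) => [j|] ->.
    have := mem_gentuple (ftail t) j; rewrite ffunE => H.
    by apply: (subsetP (joing_subl _ _)).
  by apply: (subsetP (joing_subr _ _)); apply: cycle_id.
rewrite join_subG cycle_subG mem_gentuple andbT gen_subG.
by apply/subsetP=> _ /imsetP[i _ ->]; rewrite ffunE mem_gentuple.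
Qed.

(** A transitive abelian group is regular: an element that fixes [x] commutes with the group and so
    fixes every point. Stabilisers in [A] are therefore trivial. *)
Lemma card_orbit_abelian (T : finType) (G A : {group {perm T}}) x :
  abelian G -> orbit 'P G x = setT -> A \subset G -> #|orbit 'P A x| = #|A|.
Proof.
move=> cG oG sAG; rewrite card_orbit.
suff -> : 'C_A[x | 'P] = 1 by rewrite indexg1.
apply/trivgP/subsetP=> a /setIP[aA]; rewrite inE => /andP[_]; rewrite inE sub1set inE.
move=> /eqP ax; apply/set1P/permP=> y.
have: y \in orbit 'P G x by rewrite oG inE.
case/orbitP=> b bG <-; rewrite perm1 /= /aperm -permM.
by rewrite -(centsP cG a (subsetP sAG _ aA) b bG) permM -[X in b X]/('P%act x a) ax.
Qed.

(** * Transitive tuples as towers of copies of one orbit of the tail *)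

Section Tower.
Variables (X : finType) (e l : nat) (x1 : X).
Local Notation Y := (X * 'I_e.+1)%type.

Definition pdiag_fun (p : {perm X}) (z : Y) : Y := (p z.1, z.2).
Lemma pdiag_inj p : injective (pdiag_fun p).
Proof. by move=> [x i] [y j] [] /perm_inj -> ->. Qed.
Definition pdiag p : {perm Y} := perm (@pdiag_inj p).

(** One floor up, and from the top floor back to the bottom through [u]; the power [e.+1] thus acts
    as [u] on each floor. *)
Definition pshift_fun (u : {perm X}) (z : Y) : Y :=
  if z.2 < e then (z.1, inord z.2.+1) else (u z.1, ord0).
Lemma pshift_inj u : injective (pshift_fun u).
Proof.
move=> [x i] [y j]; rewrite /pshift_fun /=.
have le (k : 'I_e.+1) : k < e = false -> k = e :> nat.
  by move=> H; apply/eqP; rewrite eqn_leq -ltnS ltn_ord leqNgt H.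
case: ifP => hi; case: ifP => hj [].
- move=> -> /(congr1 val); rewrite /= !inordK ?ltnS // => -[] ij.
  by congr pair; apply: val_inj.
- by move=> _ /(congr1 val); rewrite /= inordK.
- by move=> _ /(congr1 val); rewrite /= inordK.
by move=> /perm_inj ->; congr pair; apply: val_inj; rewrite /= (le _ hi) (le _ hj).
Qed.
Definition pshift u : {perm Y} := perm (@pshift_inj u).

Lemma pshiftX u x (j : 'I_e.+1) : (pshift u ^+ j) (x, ord0) = (x, j).
Proof.
case: j => j; elim: j => [|j IH] lj; first by rewrite expg0 perm1; congr pair; apply: val_inj.
rewrite /= expgSr permM (IH (ltnW lj)) permE /pshift_fun /= -ltnS lj.
by congr pair; apply: val_inj; rewrite /= inordK.
Qed.

Lemma pshift_last u x : (pshift u ^+ e.+1) (x, ord0) = (u x, ord0).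
Proof.
rewrite expgSr permM -[e in X in X _]/(nat_of_ord (@ord_max e)) pshiftX permE.
by rewrite /pshift_fun /= ltnn.
Qed.

Lemma pdiag_shift u p : commute u p -> commute (pshift u) (pdiag p).
Proof.
move=> c; apply/permP=> -[x i]; rewrite !permM !permE /pshift_fun /pdiag_fun /=.
by case: ifP => // _; rewrite -!permM c.
Qed.

Definition floor0 : {set Y} := [set z | z.2 == ord0].

Lemma floor0E : floor0 = (fun x => (x, ord0)) @: [set: X].
Proof.
apply/setP=> -[x i]; rewrite inE /=; apply/eqP/imsetP=> [->|[y _ [_ ->]] //].
by exists x.
Qed.

Lemma card_floor0 : #|floor0| = #|X|.
Proof. by rewrite floor0E card_imset ?cardsT // => x y []. Qed.

(** By regularity a group element is determined by the image [v] of [x1], so points of [X] encode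
    group elements. The default [1] is never reached for a transitive [s]. *)
Definition mover (s : {ffun 'I_l -> {perm X}}) v : {perm X} :=
  odflt 1 [pick u in gentuple s | u x1 == v].

Lemma moverP s v : s \in ttuples l x1 -> mover s v \in gentuple s /\ mover s v x1 = v.
Proof.
case/setIdP=> _ /eqP os; have: v \in orb s x1 by rewrite os inE.
case/orbitP=> a aG av; rewrite /mover; case: pickP => [u /andP[uG /eqP]|/(_ a)] //=.
by rewrite aG /= -av /= eqxx.
Qed.

(** The data are the action [s] of the tail on floor 0, the image [v] of [x1] under the power [e.+1]
    of the head, and a relabelling [p] of the other floors, applied by conjugation. *)
Definition tower (d : {ffun 'I_l -> {perm X}} * X * {perm Y}) : {ffun 'I_l.+1 -> {perm Y}} :=
  fcons (pshift (mover d.1.1 d.1.2) ^ d.2) [ffun i => pdiag (d.1.1 i) ^ d.2].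

Lemma tower_fix (p : {perm Y}) : perm_on (~: floor0) p -> forall x, p (x, ord0) = (x, ord0).
Proof. by move=> pp x; apply: (out_perm pp); rewrite !inE eqxx. Qed.

Section TowerFacts.
Variables (s : {ffun 'I_l -> {perm X}}) (v : X) (p : {perm Y}).
Hypotheses (st : s \in ttuples l x1) (pp : perm_on (~: floor0) p).
Let t := tower (s, v, p).

Lemma towerS i x j : t (lift ord0 i) (p (x, j)) = p (s i x, j).
Proof. by rewrite /t /tower fconsS /= ffunE permJ permE. Qed.

Lemma tower0X (j : 'I_e.+1) x : (t ord0 ^+ j) (x, ord0) = p (x, j).
Proof.
by rewrite -[in LHS](tower_fix pp) /t /tower fcons0 -conjXg permJ pshiftX.
Qed.

Lemma tower0_last : (t ord0 ^+ e.+1) (x1, ord0) = (v, ord0).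
Proof.
have [_ mv] := moverP v st.
by rewrite -[in LHS](tower_fix pp) /t /tower fcons0 -conjXg permJ pshift_last mv (tower_fix pp).
Qed.

Lemma tower_tail_orb : orb (ftail t) (x1, ord0) = floor0.
Proof.
case/setIdP: (st) => _ /eqP os.
rewrite (@orb_equivariant _ _ _ (fun x => (x, ord0)) s) ?os ?floor0E // => i y.
by rewrite ffunE -[in LHS](tower_fix pp) towerS (tower_fix pp).
Qed.

Lemma tower_ctuple : t \in ctuples _ _.
Proof.
case/setIdP: (st) => /ctuplesP cs _.
have [mG _] := moverP v st.
have cm i : commute (mover s v) (s i).
  apply/commute_sym/(cent_gentuple _ mG) => j; exact: cs.
have c0 i : commute (t ord0) (t (lift ord0 i)).
  rewrite /t /tower fcons0 fconsS ffunE /=.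
  by rewrite /commute -!conjMg pdiag_shift.
apply/ctuplesP=> i j; case: (unliftP ord0 i) => [i'|] ->; case: (unliftP ord0 j) => [j'|] -> //.
  rewrite /t /tower !fconsS !ffunE /commute -!conjMg; congr (_ ^ _).
  by apply/permP=> -[x k]; rewrite !permM !permE /pdiag_fun /= -!permM cs.
exact/commute_sym/c0.
Qed.

Lemma tower_orb : orb t (x1, ord0) = setT.
Proof.
apply/eqP; rewrite -subTset; apply/subsetP=> z _.
rewrite -(permKV p z); case: (p^-1 z) => x j; rewrite -tower0X.
have: (x, ord0) \in orb (ftail t) (x1, ord0) by rewrite tower_tail_orb inE.
case/orbitP=> a aG ax; apply/orbitP; exists (a * t ord0 ^+ j).
  rewrite groupM ?groupX ?mem_gentuple //.
  by rewrite gentuple_cons; apply: (subsetP (joing_subl _ _)).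
by rewrite /= /aperm permM -ax.
Qed.

End TowerFacts.

Definition tower_data := setX (setX (ttuples l x1) [set: X]) [set p | perm_on (~: floor0) p].

(** The powers of the head on floor 0 determine [p], the tail then determines [s], and the power
    [e.+1] of the head at the base point gives [v]. *)
Lemma tower_inj : {in tower_data &, injective tower}.
Proof.
move=> [[s v] p] [[s' v'] p'] /setXP[/setXP[st _]] + /setXP[/setXP[st' _]] +; rewrite !inE.
move=> pp pp' E.
have ep : p = p'.
  by apply/permP=> -[x j]; rewrite -(tower0X s v pp) -(tower0X s' v' pp') E.
subst p'; congr (_, _, _).
  apply/ffunP=> i; apply/permP=> x; have := towerS s v p i x ord0.
  by rewrite E towerS => /perm_inj [].
by have := tower0_last v st pp; rewrite E tower0_last // => -[].
Qed.

(** The translates of floor 0 by $g^0, \dots, g^e$ are disjoint and fill the label set, which yields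
    [p]; restricting the tail and $g^{e+1}$ to floor 0 yields [s] and [v]. *)
Lemma tower_surj t : t \in ttuples l.+1 (x1, ord0 : 'I_e.+1) ->
  orb (ftail t) (x1, ord0) = floor0 -> exists2 d, d \in tower_data & t = tower d.
Proof.
case/setIdP=> ct /eqP ot od.
pose g := t ord0; pose A := gentuple (ftail t).
have cG := ctuples_abelian ct.
have sAG : A \subset gentuple t by rewrite gentuple_cons joing_subl.
have nA : gentuple t \subset 'N(A) by apply: sub_abelian_norm cG sAG.
have gN : g \in 'N(A) by rewrite (subsetP nA) ?mem_gentuple.
have cardA : #|A| = #|X|.
  by rewrite -(card_orbit_abelian cG ot sAG) -[orbit _ _ _]/(orb _ _) od card_floor0.
have cardG : #|gentuple t| = (#|X| * e.+1)%N.
  by rewrite -(card_orbit_abelian cG ot (subxx _)) -[orbit _ _ _]/(orb _ _) ot cardsT card_prod card_ord.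
have X0 : 0 < #|X| by apply/card_gt0P; exists x1.
(* The quotient by [A] is generated by the class of [g], so the order of this class is the index of
   [A], a quotient of two orders known by regularity. *)
have og : #[coset A g] = e.+1.
  rewrite orderE -quotient_cycle // -quotientYidl ?cycle_subG // -gentuple_cons.
  by rewrite card_quotient // -divgS // cardG cardA mulKn.
have gA n : (g ^+ n \in A) = (e.+1 %| n).
  transitivity (#[coset A g] %| n); last by rewrite og.
  rewrite order_dvdn -morphX //; apply/idP/eqP=> [H|H]; first exact: coset_id.
  by apply: coset_idr H; rewrite groupX.
have cgt i n : commute (g ^+ n) (t i) by apply/commute_sym/commuteX/(ctuplesP _ ct).
(* Off floor 0 the condition on [a] is vacuous and [1] is a dummy witness. *)
have oT z : exists2 a, a \in A & z.2 = ord0 -> a (x1, ord0) = z.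
  case: (eqVneq z.2 ord0) => [z0|nz]; last by exists 1 => // z0; rewrite z0 eqxx in nz.
  have: z \in orb (ftail t) (x1, ord0) by rewrite od inE z0.
  by case/orbitP=> a aA az; exists a.
pose pf (z : Y) := (g ^+ z.2) (z.1, ord0 : 'I_e.+1).
(* If two translates meet, freeness gives [g ^+ (j - i) \in A], so [e.+1] divides [j - i]; as
   [j - i <= e], the floors coincide. *)
have key (x y : X) (i j : 'I_e.+1) : i <= j -> pf (x, i) = pf (y, j) -> i = j.
  move=> lij E; have [a aA ax] := oT (x, ord0); have [b bA byy] := oT (y, ord0).
  have E2 : a * g ^+ i = b * g ^+ j.
    apply: (@transitive_commute_inj _ _ t (x1, ord0)) => //.
    - move=> k; apply: commute_sym; apply: commuteM; last by apply/commute_sym/cgt.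
      by apply: (centsP cG); rewrite ?mem_gentuple ?(subsetP sAG).
    - move=> k; apply: commute_sym; apply: commuteM; last by apply/commute_sym/cgt.
      by apply: (centsP cG); rewrite ?mem_gentuple ?(subsetP sAG).
    by rewrite !permM ax // byy.
  have: g ^+ (j - i) \in A.
    have -> : g ^+ (j - i) = b^-1 * a.
      apply: (mulIg (g ^+ i)); rewrite -expgD subnK //.
      by apply: (mulgI b); rewrite -E2 !mulgA mulgV mul1g.
    by rewrite groupM ?groupV.
  rewrite gA => /dvdn_leq; case: (posnP (j - i)) => [/eqP|h /(_ isT)].
    by rewrite subn_eq0 => lji _; apply/val_inj/eqP; rewrite eqn_leq lij.
  by move=> H; have := leq_ltn_trans (leq_subr i j) (ltn_ord j); rewrite ltnNge H.
have pfi : injective pf.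
  move=> [x i] [y j] E; have ij : i = j.
    by case: (leqP i j) => [/key|/ltnW/key]; [apply; exact: E | move=> K; apply/esym/K/esym/E].
  by move: E; rewrite ij /pf /= => /perm_inj [->].
pose p := perm pfi.
have pE x i : p (x, i) = (g ^+ i) (x, ord0) by rewrite permE.
have fl i x : t (lift ord0 i) (x, ord0) \in floor0.
  by have := @orb_closed _ _ (ftail t) (x1, ord0) i (x, ord0); rewrite od ffunE; apply; rewrite inE.
have pairi : injective (fun x : X => (x, ord0 : 'I_e.+1)) by move=> ? ? [].
have /fin_all_exists[s0 sE] i :
    exists q : {perm X}, forall x, t (lift ord0 i) (x, ord0) = (q x, ord0).
  apply: (perm_restrict pairi) => x; move: (fl i x); rewrite floor0E => /imsetP[y _ ->].
  exact: codom_f.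
pose s := finfun s0.
have [u uE] : exists u : {perm X}, forall x, (g ^+ e.+1) (x, ord0) = (u x, ord0).
  apply: (perm_restrict pairi) => x.
  have : (g ^+ e.+1) (x, ord0) \in orb (ftail t) (x1, ord0).
    have [a aA ax] := oT (x, ord0); rewrite -ax //; apply/orbitP; exists (a * g ^+ e.+1).
      by rewrite groupM // gA.
    by rewrite /= /aperm permM.
  by rewrite od floor0E => /imsetP[y _ ->]; apply: codom_f.
have st : s \in ttuples l x1.
  apply/setIdP; split.
    apply/ctuplesP=> i j; apply/permP=> x; apply: pairi; rewrite !permM !ffunE -!sE -!permM.
    by rewrite (ctuplesP _ ct).
  apply/eqP/(imset_inj pairi); rewrite -(@orb_equivariant _ _ _ _ s (ftail t)) ?od ?floor0E // => i y.
  by rewrite !ffunE sE.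
have [mG mv] := moverP (u x1) st.
(* Both sides commute with the transitive tuple [s] and agree at [x1]. *)
have um : mover s (u x1) = u.
  case/setIdP: (st) => /ctuplesP cs /eqP os.
  apply: (transitive_commute_inj os) => //.
    by move=> i; apply/commute_sym/(cent_gentuple _ mG) => j; apply: cs.
  move=> i; apply/permP=> x; apply: pairi; rewrite !permM !ffunE -uE -!sE -uE -!permM.
  by rewrite -cgt.
have pp : perm_on (~: floor0) p.
  apply/subsetP=> -[x i]; rewrite !inE /=; apply: contra => /eqP ->.
  by rewrite pE expg0 perm1.
exists (s, u x1, p); first by do 2?[apply/setXP; split=> //]; rewrite ?inE.
apply/ffunP=> i; apply/permP=> z; rewrite -(permKV p z); case: (p^-1 z) => x j.
case: (unliftP ord0 i) => [k|] ->.
  rewrite towerS !pE ffunE -permM (cgt _ _) permM sE //.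
rewrite /tower fcons0 /= um permJ [pshift _ _]permE /pshift_fun /=; case: ifP => lj.
  by rewrite !pE inordK // expgSr permM.
have je : j = e :> nat by apply/eqP; rewrite eqn_leq -ltnS ltn_ord leqNgt lj.
by rewrite !pE expg0 perm1 je -permM -expgSr uE.
Qed.

(** The factors count [s], [v] and [p]; the last one permutes the [#|X| * e] points outside floor
    0. *)
Lemma card_tower :
  #|[set t in ttuples l.+1 (x1, ord0 : 'I_e.+1) | orb (ftail t) (x1, ord0) == floor0]| =
  (#|ttuples l x1| * #|X| * (#|X| * e)`!)%N.
Proof.
have -> : (#|ttuples l x1| * #|X| * (#|X| * e)`!)%N = #|tower_data|.
  have cp : #|[set p | perm_on (~: floor0) p]| = #|~: floor0|`!.
    by rewrite -card_perm; apply: eq_card => q; rewrite inE.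
  rewrite !cardsX cardsT cp; congr (_ * _`!)%N.
  by rewrite cardsCs setCK card_floor0 card_prod card_ord mulnS addKn.
rewrite -(card_in_imset tower_inj); apply: eq_card => t; rewrite inE.
apply/andP/imsetP=> [[tt /eqP od]|[[[s v] p] /setXP[/setXP[st _]]]].
  by have [d dd ->] := tower_surj tt od; exists d.
rewrite inE => pp ->; rewrite tower_tail_orb //; split=> //.
by apply/setIdP; rewrite tower_ctuple // tower_orb.
Qed.

End Tower.

(** * Recurrences *)

Lemma imset_eq_inj (T T' : finType) (f : T' -> T) (A B : {set T'}) :
  injective f -> (f @: A == f @: B) = (A == B).
Proof. by move=> fi; apply/eqP/eqP=> [/(imset_inj fi)|->]. Qed.

Lemma imset_bijT (T T' : finType) (f : T' -> T) : bijective f -> f @: setT = setT.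
Proof. by case=> g fK gK; apply/setP=> x; rewrite inE -(gK x) imset_f. Qed.

Lemma in_setId (T : finType) (A : {set T}) (P : pred T) x :
  (x \in [set y in A | P y]) = (x \in A) && P x.
Proof. by rewrite inE. Qed.

(** A bijection sending the left summand of a sum type onto [D] reduces this to [card_split]. *)
Lemma card_ctuples_orb (T : finType) l (x : T) (D : {set T}) k :
    x \in D -> #|D| = k.+1 ->
  #|[set t in ctuples T l | orb t x == D]| =
  (#|ttuples l (ord0 : 'I_k.+1)| * #|ctuples 'I_(#|T| - k.+1) l|)%N.
Proof.
move=> xD cD; set T2 := 'I_(#|T| - k.+1).
have inli : injective (@inl 'I_k.+1 T2) by move=> ? ? [].
have lk : k.+1 <= #|T| by rewrite -cD max_card.
have [|||f [fb fx fD]] :=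
  @exists_pointed_bijection T ('I_k.+1 + T2)%type D (inl @: setT) x (inl ord0) _ _ xD.
- by rewrite card_sum !card_ord subnKC.
- by rewrite cD card_imset // cardsT card_ord.
- by rewrite imset_f.
rewrite -(card_split _ _ ord0).
have fi := bij_inj fb; case: (fb) => g fK gK; rewrite (card_relabel fK gK).
apply: eq_card => t; rewrite !inE -fx relabel_orb -fD imset_eq_inj //; congr (_ && _).
by have := relabel_ctuples fK gK t; rewrite !inE.
Qed.

(** A subset of size $k+1$ containing [x] amounts to a choice of $k$ of the other $m$ points. *)
Lemma sum_pointed_subsets (T : finType) (x : T) m (F : nat -> nat) :
    #|T| = m.+1 ->
  (\sum_(D : {set T} | x \in D) F #|D| = \sum_(k < m.+1) 'C(m, k) * F k.+1)%N.
Proof.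
move=> cT; rewrite (partition_big (fun D : {set T} => inord #|D|.-1 : 'I_m.+1) predT) //=.
apply: eq_bigr => k _.
have cD (D : {set T}) : x \in D -> #|D| = #|D|.-1.+1.
  by move=> xD; rewrite prednK //; apply/card_gt0P; exists x.
have eP (D : {set T}) : x \in D -> ((inord #|D|.-1 : 'I_m.+1) == k) = (#|D| == k.+1).
  move=> xD; rewrite -val_eqE /= inordK -?cD //; first by rewrite [in RHS]cD.
  by rewrite -cT max_card.
pose P := [set D : {set T} | (x \in D) && (#|D| == k.+1)].
rewrite (eq_bigl (fun D => D \in P)); last first.
  by move=> D; rewrite [RHS]inE; case xD: (x \in D); rewrite // !andTb eP.
rewrite (eq_bigr (fun=> F k.+1)); last by move=> D; rewrite inE => /andP[_ /eqP ->].
rewrite sum_nat_const; congr (_ * _)%N.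
have -> : P = [set x |: B | B in [set B : {set T} | B \subset [set~ x] & #|B| == k]].
  apply/setP=> D; rewrite inE; apply/andP/imsetP=> [[xD /eqP cDk]|[B + ->]].
    exists (D :\ x); last by rewrite setD1K.
    rewrite inE [X in X && _](_ : _ = true); last first.
      by apply/subsetP=> y; rewrite !inE => /andP[].
    by move: cDk; rewrite (cardsD1 x) xD add1n => -[->]; rewrite eqxx.
  rewrite inE => /andP[sB /eqP cB]; rewrite setU11; split=> //.
  have xB : x \notin B by apply/negP=> /(subsetP sB); rewrite !inE eqxx.
  by rewrite cardsU1 xB cB.
rewrite card_in_imset ?cards_draws.
  by rewrite cardsC1 cT.
move=> B C; rewrite !inE => /andP[sB _] /andP[sC _] e.
have xB : x \notin B by apply/negP=> /(subsetP sB); rewrite !inE eqxx.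
have xC : x \notin C by apply/negP=> /(subsetP sC); rewrite !inE eqxx.
by rewrite -(setU1K xB) e setU1K.
Qed.

Lemma card_ctuples_rec l n :
  (#|ctuples 'I_n.+1 l| =
   \sum_(k < n.+1) 'C(n, k) * (#|ttuples l (ord0 : 'I_k.+1)| * #|ctuples 'I_(n - k) l|))%N.
Proof.
(* [F] is a function of the orbit size, which is positive, so [k.-1.+1] is [k] where it matters. *)
pose F k := (#|ttuples l (ord0 : 'I_k.-1.+1)| * #|ctuples 'I_(n.+1 - k) l|)%N.
rewrite -[RHS](@sum_pointed_subsets 'I_n.+1 ord0 n F (card_ord _)).
rewrite -sum1_card (partition_big (fun t => orb t ord0) (fun D => ord0 \in D)) /=; last first.
  by move=> t _; apply: orb_refl.
apply: eq_bigr => D xD.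
have cD : #|D| = #|D|.-1.+1 by rewrite prednK //; apply/card_gt0P; exists ord0.
rewrite sum1dep_card /F cD /=.
have := card_ctuples_orb l xD cD; rewrite card_ord => <-.
by apply: eq_card => t; rewrite !inE.
Qed.

(* The number of subgroups of index [k] in [Z^l], for [k > 0]. *)
Fixpoint nsub (l k : nat) : nat :=
  (if l is l'.+1 then \sum_(d < k.+1 | d %| k) d * nsub l' d else k == 1)%N.

(** When the size of [D] divides that of [T], a bijection makes [D] the bottom floor of a tower and
    [card_tower] applies. *)
Lemma card_ttuples_tail (T : finType) l (x : T) (D : {set T}) d :
    x \in D -> #|D| = d.+1 ->
  #|[set t in ttuples l.+1 x | orb (ftail t) x == D]| =
  (if d.+1 %| #|T| then #|ttuples l (ord0 : 'I_d.+1)| * d.+1 * (#|T| - d.+1)`! else 0)%N.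
Proof.
(* A zero quotient would make [T] empty although it contains [D]; otherwise the number of floors is
   [e.+1]. *)
move=> xD cD; case: ifP => [/dvdnP[[|e] cT]|nd]; first by have := max_card (mem D); rewrite cT cD.
- have [|||f [fb fx fD]] :=
    @exists_pointed_bijection T ('I_d.+1 * 'I_e.+1)%type D (floor0 _ _) x (ord0, ord0) _ _ xD.
  + by rewrite card_prod !card_ord cT mulnC.
  + by rewrite card_floor0 cD card_ord.
  + by rewrite inE.
  have -> : (#|T| - d.+1 = d.+1 * e)%N by rewrite cT mulSn addKn mulnC.
  have := @card_tower 'I_d.+1 e l ord0; rewrite card_ord => <-.
  have fT := imset_bijT fb; have fi := bij_inj fb; case: (fb) => g fK gK.
  rewrite (card_relabel fK gK); apply: eq_card => t.
  have rt : ftail (relabel_tuple fK gK t) = relabel_tuple fK gK (ftail t).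
    by apply/ffunP=> i; rewrite !ffunE.
  rewrite [LHS]inE [RHS]inE rt -fx relabel_orb -fD imset_eq_inj //; congr (_ && _).
  rewrite /ttuples 2!in_setId.
  by rewrite relabel_ctuples relabel_orb -[X in _ == X]fT imset_eq_inj.
(* No such tuple exists: by regularity the tail group has order [#|D|] and the whole group has order
   [#|T|], so Lagrange's theorem would force divisibility. *)
apply/eqP; rewrite cards_eq0 -subset0; apply/subsetP=> t /setIdP[/setIdP[ct /eqP ot] /eqP od].
have cG := ctuples_abelian ct.
have sAG : gentuple (ftail t) \subset gentuple t by rewrite gentuple_cons joing_subl.
move: nd; have -> : #|T| = #|gentuple t|.
  by rewrite -(card_orbit_abelian cG ot (subxx _)) -[orbit _ _ _]/(orb _ _) ot cardsT.
rewrite -cD -od /orb (card_orbit_abelian cG ot sAG).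
by rewrite cardSg.
Qed.

(** Sorting the tuples by the orbit of [ord0] under the tail gives the recurrence of [nsub], the
    binomial coefficient and the factorials combining to $k!$. For [l = 0] the group is trivial,
    hence transitive on a single point only. *)
Lemma card_ttuplesE l k : #|ttuples l (ord0 : 'I_k.+1)| = (k`! * nsub l k.+1)%N.
Proof.
elim: l k => [|l IH] k.
  rewrite /= eqSS; case: k => [|k] /=.
    rewrite muln1 -[RHS](_ : #|[set: {ffun 'I_0 -> {perm 'I_1}}]| = _).
      apply: eq_card => t; rewrite !inE; apply/andP; split; first by apply/forallP=> -[].
      rewrite -subTset; apply/subsetP=> y _; rewrite (ord1 y); exact: orb_refl.
    by rewrite cardsT card_ffun card_ord expn0.
  rewrite muln0; apply: eq_card0 => t; apply/negP=> /setIdP[_ /eqP ot].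
  have : orb t ord0 \subset [set ord0] by apply: orb_min => [|[]//]; rewrite inE.
  by rewrite ot subTset => /eqP /(congr1 (fun A => #|pred_of_set A|)); rewrite cardsT cards1 card_ord.
pose F d := (if d %| k.+1 then #|ttuples l (ord0 : 'I_d.-1.+1)| * d * (k.+1 - d)`! else 0)%N.
transitivity (\sum_(D : {set 'I_k.+1} | ord0 \in D) F #|D|)%N.
  rewrite -sum1_card (partition_big (fun t => orb (ftail t) ord0) (fun D => ord0 \in D)) /=; last first.
    by move=> t _; apply: orb_refl.
  apply: eq_bigr => D xD.
  have cD : #|D| = #|D|.-1.+1 by rewrite prednK //; apply/card_gt0P; exists ord0.
  rewrite sum1dep_card /F cD /=.
  have := card_ttuples_tail l xD cD; rewrite card_ord => <-.
  by apply: eq_card => t; rewrite !inE.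
rewrite (@sum_pointed_subsets 'I_k.+1 ord0 k F (card_ord _)).
rewrite -[nsub l.+1 k.+1]/(\sum_(d < k.+2 | d %| k.+1) d * nsub l d)%N.
rewrite [in RHS]big_mkcond [in RHS]big_ord_recl /= add0n big_distrr /=.
apply: eq_bigr => d _; rewrite /F /= /bump /= add1n; case: ifP => _; rewrite ?muln0 //.
have dk : (d <= k)%N by rewrite -ltnS.
rewrite IH subSS -(bin_fact dk) -!mulnA; congr (_ * (_ * _))%N.
by rewrite mulnC -mulnA [in RHS]mulnCA.
Qed.

Lemma card_commuting_rec l n :
  (#|commuting_tuples l n.+1| =
   \sum_(k < n.+1) n ^_ k * nsub l k.+1 * #|commuting_tuples l (n - k)|)%N.
Proof.
rewrite -[LHS]/(#|ctuples 'I_n.+1 l|) card_ctuples_rec; apply: eq_bigr => k _.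
by rewrite card_ttuplesE !mulnA bin_ffact.
Qed.

Lemma card_commuting0 l : #|commuting_tuples l 0| = 1%N.
Proof.
rewrite -[LHS]/(#|ctuples 'I_0 l|).
have -> : ctuples 'I_0 l = [set: _].
  by apply/setP=> t; rewrite [RHS]inE; apply/ctuplesP=> i j; apply/permP=> -[].
by rewrite cardsT card_ffun card_Sn exp1n.
Qed.

Local Close Scope group_scope.
Local Open Scope Z_scope.

Lemma Z_of_nat_sum (I : Type) (s : seq I) (P : pred I) (F : I -> nat) :
  Z.of_nat (\sum_(i <- s | P i) F i) = foldr Z.add 0 [seq Z.of_nat (F i) | i <- s & P i].
Proof.
elim: s => [|i s IH]; first by rewrite big_nil.
by rewrite big_cons /=; case: (P i) => //=; rewrite -IH Nat2Z.inj_add.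
Qed.

(** * The recurrence for the counts, evaluated in an abstract arithmetic *)

Section Convolution.
Variables (V : Type) (zero one : V) (add mul : V -> V -> V) (scal : Z -> V -> V).
Variable post : nat -> V -> V.

(** The weight [f] runs through the falling factorials, [n] being its next factor; [al] is listed by
    increasing index from 1 and [xs] by decreasing index. *)
Fixpoint conv (f n : Z) (al xs : seq V) : V :=
  match al, xs with
  | a :: al', x :: xs' => add (mul (scal f a) x) (conv (f * n) (n - 1) al' xs')
  | _, _ => zero
  end.

(* The values are listed by decreasing index. *)
Fixpoint build (al : seq V) (m : nat) : seq V :=
  if m is m'.+1 then
    let xs := build al m' in post m (conv 1 (Z.of_nat m') al xs) :: xs
  else [:: one].

(** Read [rel v z] as: [v] encloses the integer [z]. The instances are floating-point intervals,
    with [scale] 1, and truncated exponential polynomials, with [scale] 210; [post] is the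
    truncation in the latter. *)
Variable rel : V -> Z -> Prop.
Hypotheses (rel0 : rel zero 0) (rel1 : rel one 1).
Hypothesis relD : forall v w y z, rel v y -> rel w z -> rel (add v w) (y + z).
Hypothesis relM : forall v w y z, rel v y -> rel w z -> rel (mul v w) (y * z).
Hypothesis relZ : forall (c : nat) v y,
  rel v y -> rel (scal (Z.of_nat c) v) (Z.of_nat c * y).
Hypothesis rel_post : forall n v y, rel v y -> rel (post n v) y.

Variables (a x : nat -> nat).
Variable scale : Z.
Hypothesis x0 : x 0%N = 1%N.
Hypothesis xS : forall n, x n.+1 = (\sum_(k < n.+1) n ^_ k * a k.+1 * x (n - k))%N.

Let sc n z := scale ^ Z.of_nat n * Z.of_nat z.

Variable al : seq V.
Hypothesis al_rel : forall i, (i < size al)%N -> rel (nth zero al i) (sc i.+1 (a i.+1)).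

Let powS n : scale ^ Z.of_nat n.+1 = scale * scale ^ Z.of_nat n.
Proof. by rewrite Nat2Z.inj_succ Z.pow_succ_r //; lia. Qed.

(** This is the state after [j] terms, so that induction on the remaining number [m] goes through.
    The scaling is homogeneous: every term carries the power $m+1+j = n+1$ of [scale]. *)
Lemma conv_rel n m j xs : (m + j)%N = n -> (n < size al)%N -> size xs = m.+1 ->
    (forall i, (i <= m)%N -> rel (nth zero xs i) (sc (m - i) (x (m - i)))) ->
  rel (conv (Z.of_nat (n ^_ j)) (Z.of_nat m) (drop j al) xs)
      (sc m.+1 (\sum_(k < m.+1) n ^_ (j + k) * a (j + k).+1 * x (m - k)) * scale ^ Z.of_nat j).
Proof.
elim: m j xs => [|m IH] j [//|y xs] mj ns [sx] H.
  case: xs sx {H} (H 0%N isT) => // _ /= Hy.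
  rewrite add0n in mj; subst j; rewrite (drop_nth zero) //= big_ord1 addn0.
  have -> : sc 1 (n ^_ n * a n.+1 * x (0 - 0)) * scale ^ Z.of_nat n =
     (Z.of_nat (n ^_ n) * sc n.+1 (a n.+1) * sc 0 (x 0%N)) + 0.
    by rewrite /sc subnn x0 !Nat2Z.inj_mul !powS -[scale ^ Z.of_nat 0]/1 -[Z.of_nat 1]/1; ring.
  (* The list of values is exhausted here, so the result is [zero] whatever the weight. *)
  have -> : conv (Z.of_nat (n ^_ n) * 0) (-1) (drop n.+1 al) [::] = zero by case: drop.
  by apply: relD => //; apply: relM => //; apply: relZ; apply: al_rel.
rewrite (drop_nth zero); last by apply: leq_trans ns; rewrite -mj ltnS leq_addl.
rewrite -[conv _ _ _ _]/(add (mul (scal (Z.of_nat (n ^_ j)) (nth zero al j)) y)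
  (conv (Z.of_nat (n ^_ j) * Z.of_nat m.+1) (Z.of_nat m.+1 - 1) (drop j.+1 al) xs)).
have -> : sc m.+2 (\sum_(k < m.+2) n ^_ (j + k) * a (j + k).+1 * x (m.+1 - k)) * scale ^ Z.of_nat j
  = (Z.of_nat (n ^_ j) * sc j.+1 (a j.+1) * sc m.+1 (x m.+1)) +
    sc m.+1 (\sum_(k < m.+1) n ^_ (j.+1 + k) * a (j.+1 + k).+1 * x (m - k)) * scale ^ Z.of_nat j.+1.
  rewrite big_ord_recl addn0 subn0 /sc.
  rewrite (eq_bigr (fun k : 'I_m.+1 => n ^_ (j.+1 + k) * a (j.+1 + k).+1 * x (m - k))%N); last first.
    by move=> k _; rewrite /= /bump /= add1n subSS addSnnS.
  rewrite Nat2Z.inj_add !Nat2Z.inj_mul !powS.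
  move: (\sum_(k < m.+1) n ^_ (j.+1 + k) * a (j.+1 + k).+1 * x (m - k))%N => S.
  by ring.
apply: relD.
  apply: relM; last by have := H 0%N isT; rewrite subn0.
  by apply: relZ; apply: al_rel; apply: leq_trans ns; rewrite -mj ltnS leq_addl.
have -> : Z.of_nat (n ^_ j) * Z.of_nat m.+1 = Z.of_nat (n ^_ j.+1).
  rewrite -Nat2Z.inj_mul ffactnSr; congr (Z.of_nat (_ * _)).
  by rewrite -mj addnK.
have -> : Z.of_nat m.+1 - 1 = Z.of_nat m by lia.
apply: IH => //; first by rewrite -mj addSnnS.
by move=> i im; have := H i.+1 im; rewrite subSS.
Qed.

Lemma build_rel m : (m <= size al)%N ->
  size (build al m) = m.+1 /\
  forall i, (i <= m)%N -> rel (nth zero (build al m) i) (sc (m - i) (x (m - i))).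
Proof.
elim: m => [|m IH] ms.
  by split=> // i; rewrite leqn0 => /eqP ->; rewrite /= /sc subnn x0 Z.pow_0_r.
have [sb H] := IH (ltnW ms); split; first by rewrite /= sb.
case=> [_|i im]; last by rewrite subSS; apply: H.
rewrite subn0 [nth _ _ _]/=; apply: rel_post; rewrite xS.
have := @conv_rel m m 0%N (build al m) (addn0 m) ms sb H.
rewrite ffactn0 drop0 Z.pow_0_r Z.mul_1_r.
by under eq_bigr do rewrite add0n.
Qed.

End Convolution.

(** * Small [l]: floating-point enclosures *)

Definition exceptional (n l : nat) : bool :=
     [|| (n == 1) && (2 <= l),
         (n == 3) && (2 <= l <= 13),
         (n == 4) && (16 <= l),
         (n == 5) && (2 <= l <= 19),
         (n == 7) && (2 <= l),
         (n == 8) && (15 <= l <= 26),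
         (n == 9) && (2 <= l <= 12),
         (n == 10) && (22 <= l),
         (n == 11) && (2 <= l <= 35),
         (n == 13) && ((2 <= l <= 9) || (26 <= l)),
         (n == 14) && (20 <= l <= 44),
         (n == 15) && (2 <= l <= 8),
         (n == 16) && (29 <= l),
         (n == 17) && ((2 <= l <= 6) || (24 <= l <= 54)),
         (n == 19) && ((2 <= l <= 4) || (32 <= l)) |
         (n == 20) && (27 <= l)]%N.

Definition ctZ l n : Z := Z.of_nat #|commuting_tuples l n|.

(** For [f := ctZ l] and $n > 0$ this is [Delta l n] multiplied by the positive number $(n+1)
    (n!)^2$. *)
Definition disc (f : nat -> Z) (n : nat) : Z :=
  Z.of_nat n.+1 * f n * f n - Z.of_nat n * f n.-1 * f n.+1.

(** Entry $i$ of a row holds $a_l(i+1)$. Rows reach index 21 because the discriminant at 20 involves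
    the count on 21 points. *)
Definition astep (al : seq Z) : seq Z :=
  [seq foldr Z.add 0 [seq Z.of_nat d * nth 0 al d.-1 | d <- iota 1 k & (d %| k)%N] | k <- iota 1 21].

Definition arow_rel l (al : seq Z) :=
  size al = 21%N /\ forall i, (i < 21)%N -> nth 0 al i = Z.of_nat (nsub l i.+1).

Lemma nsub_rec l k : (0 < k)%N ->
  nsub l.+1 k = (\sum_(d <- iota 1 k | d %| k) d * nsub l d)%N.
Proof.
move=> k0; rewrite /= -(big_mkord (fun d => d %| k)%N (fun d => d * nsub l d)%N).
rewrite [in LHS]big_mkcond big_ltn // mul0n if_same.
by rewrite /= add0n -big_mkcond /index_iota subSS subn0.
Qed.

Lemma astep_rel l al : arow_rel l al -> arow_rel l.+1 (astep al).
Proof.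
move=> [sa H]; split; first by rewrite size_map size_iota.
move=> i i21; rewrite (nth_map 0%N) ?size_iota // nth_iota // add1n nsub_rec // Z_of_nat_sum.
congr foldr; apply/eq_in_map => d; rewrite mem_filter mem_iota => /andP[_ /andP[d1 d2]].
rewrite H; first by rewrite prednK // Nat2Z.inj_mul.
by move: d2; rewrite prednK // add1n ltnS => d2; apply: leq_trans d2 i21.
Qed.

(** * Interval arithmetic with mantissas of about [p] bits *)

Section Floats.
Variable p : Z.

(** A triple $(m, r, e)$ stands for the interval from $m 2^e$ to $(m+r) 2^e$. *)
Definition flt := (Z * Z * Z)%type.

Definition flt_rel (v : flt) (z : Z) :=
  let: (m, r, e) := v in
  [/\ 0 <= m, 0 <= r, 0 <= e, m * 2 ^ e <= z & z <= (m + r) * 2 ^ e].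

(** Rounding [m] and [r] down loses less than one unit each, and the added 2 covers both losses. *)
Definition fshift (s : Z) (v : flt) : flt :=
  let: (m, r, e) := v in
  if s <=? 0 then v else (Z.shiftr m s, Z.shiftr r s + 2, e + s).

Definition fnorm (v : flt) : flt := fshift (Z.log2 v.1.1 + 1 - p) v.

(** At most one of the two shifts is effective; both operands end at the larger exponent. *)
Definition fadd (v w : flt) : flt :=
  let: (m, r, e) := fshift (w.2 - v.2) v in
  let: (m', r', _) := fshift (v.2 - w.2) w in
  (m + m', r + r', e).

Definition fmul (v w : flt) : flt :=
  let: (m, r, e) := v in
  let: (m', r', e') := w in
  fnorm (m * m', m * r' + r * (m' + r'), e + e').

Definition fscal (c : Z) (v : flt) : flt := fmul (fnorm (c, 0, 0)) v.

Lemma flt_rel_shift s v z : flt_rel v z -> flt_rel (fshift s v) z.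
Proof.
case: v => [[m r] e] [m0 r0 e0 lo hi]; rewrite /fshift; case: Z.leb_spec => // s0.
have s1 : 0 < 2 ^ s by apply: Z.pow_pos_nonneg; lia.
rewrite !Z.shiftr_div_pow2; try lia.
have [dm dr] := (Z.div_mod m (2 ^ s) ltac:(lia), Z.div_mod r (2 ^ s) ltac:(lia)).
have [bm br] := (Z.mod_pos_bound m _ s1, Z.mod_pos_bound r _ s1).
have [qm qr] := (Z.div_pos m _ m0 s1, Z.div_pos r _ r0 s1).
have E0 : 0 < 2 ^ e by apply: Z.pow_pos_nonneg; lia.
split; try lia; rewrite Z.pow_add_r; try lia.
apply: (Z.le_trans _ _ _ hi); rewrite (Z.mul_comm (2 ^ e)) Z.mul_assoc.
apply: Z.mul_le_mono_nonneg_r; nia.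
Qed.

Lemma flt_rel_norm v z : flt_rel v z -> flt_rel (fnorm v) z. Proof. exact: flt_rel_shift. Qed.

Lemma fshift_exp s v : (fshift s v).2 = v.2 + Z.max 0 s.
Proof. by case: v => [[m r] e]; rewrite /fshift; case: Z.leb_spec => /=; lia. Qed.

Lemma flt_relD v w y z : flt_rel v y -> flt_rel w z -> flt_rel (fadd v w) (y + z).
Proof.
move=> hv hw; rewrite /fadd.
have := flt_rel_shift (w.2 - v.2) hv; have := flt_rel_shift (v.2 - w.2) hw.
have := fshift_exp (w.2 - v.2) v; have := fshift_exp (v.2 - w.2) w.
case: fshift => [[m' r'] e']; case: fshift => [[m r] e] /= E' E.
have -> : e' = e by lia.
by move=> [? ? ? ? ?] [? ? ? ? ?]; split; lia.
Qed.

Lemma flt_relM v w y z : flt_rel v y -> flt_rel w z -> flt_rel (fmul v w) (y * z).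
Proof.
case: v w => [[m r] e] [[m' r'] e'] [m0 r0 e0 lo hi] [m0' r0' e0' lo' hi'].
apply: flt_rel_norm; rewrite /flt_rel Z.pow_add_r //.
have E0 : 0 < 2 ^ e by apply: Z.pow_pos_nonneg; lia.
have E0' : 0 < 2 ^ e' by apply: Z.pow_pos_nonneg; lia.
by split; nia.
Qed.

Lemma flt_rel_exact z : 0 <= z -> flt_rel (z, 0, 0) z.
Proof. by move=> z0; split=> //; rewrite Z.pow_0_r; lia. Qed.

Lemma flt_relZ (c : nat) v y : flt_rel v y -> flt_rel (fscal (Z.of_nat c) v) (Z.of_nat c * y).
Proof. by move=> h; apply: flt_relM h; apply: flt_rel_norm; apply: flt_rel_exact; lia. Qed.

Definition fltb (m e m' e' : Z) : bool :=
  let d := Z.min e e' in Z.shiftl m (e - d) <? Z.shiftl m' (e' - d).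

Lemma fltbE m e m' e' : 0 <= e -> 0 <= e' -> fltb m e m' e' = (m * 2 ^ e <? m' * 2 ^ e').
Proof.
move=> e0 e0'; rewrite /fltb; set d := Z.min e e'.
rewrite !Z.shiftl_mul_pow2; try lia.
have -> : 2 ^ e = 2 ^ (e - d) * 2 ^ d by rewrite -Z.pow_add_r; [congr (_ ^ _)| |]; lia.
have -> : 2 ^ e' = 2 ^ (e' - d) * 2 ^ d by rewrite -Z.pow_add_r; [congr (_ ^ _)| |]; lia.
have d0 : 0 < 2 ^ d by apply: Z.pow_pos_nonneg; lia.
by rewrite !Z.mul_assoc; apply/Z.ltb_spec0/Z.ltb_spec0; nia.
Qed.

(** Each claimed sign is tested against the least favourable ends of the three intervals, so success
    is a certificate while failure decides nothing. *)
Definition disc_check (u v w : flt) (n : nat) (b : bool) : bool :=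
  let: (m, r, e) := u in
  let: (m', r', e') := v in
  let: (m'', r'', e'') := w in
  if b then fltb (Z.of_nat n.+1 * ((m' + r') * (m' + r'))) (e' + e') (Z.of_nat n * (m * m'')) (e + e'')
  else ~~ fltb (Z.of_nat n.+1 * (m' * m')) (e' + e') (Z.of_nat n * ((m + r) * (m'' + r''))) (e + e'').

Lemma disc_checkP u v w n b x y z : flt_rel u x -> flt_rel v y -> flt_rel w z -> disc_check u v w n b ->
  (Z.of_nat n.+1 * y * y - Z.of_nat n * x * z <? 0) = b.
Proof.
case: u v w => [[m r] e] [[m' r'] e'] [[m'' r''] e''] [? ? ? lx hx] [? ? ? ly hy] [? ? ? lz hz].
have E0 : 0 < 2 ^ e by apply: Z.pow_pos_nonneg; lia.
have E0' : 0 < 2 ^ e' by apply: Z.pow_pos_nonneg; lia.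
have E0'' : 0 < 2 ^ e'' by apply: Z.pow_pos_nonneg; lia.
have x0 : 0 <= x by nia.
have y0 : 0 <= y by nia.
have z0 : 0 <= z by nia.
rewrite /disc_check; case: b; rewrite fltbE ?Z.pow_add_r //; try lia.
  move/Z.ltb_lt=> h; apply/Z.ltb_lt.
  have h1 : m * 2 ^ e * (m'' * 2 ^ e'') <= x * z by apply: Z.mul_le_mono_nonneg; nia.
  have h2 : y * y <= (m' + r') * 2 ^ e' * ((m' + r') * 2 ^ e') by apply: Z.mul_le_mono_nonneg; nia.
  nia.
move/negP=> h; apply/Z.ltb_ge.
have {}h : ~ (Z.of_nat n.+1 * (m' * m') * (2 ^ e' * 2 ^ e') <
              Z.of_nat n * ((m + r) * (m'' + r'')) * (2 ^ e * 2 ^ e'')).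
  by move/Z.ltb_lt.
have h1 : x * z <= (m + r) * 2 ^ e * ((m'' + r'') * 2 ^ e'') by apply: Z.mul_le_mono_nonneg; nia.
have h2 : m' * 2 ^ e' * (m' * 2 ^ e') <= y * y by apply: Z.mul_le_mono_nonneg; nia.
nia.
Qed.

End Floats.

(** The list runs from index 21 down to 0, so the value at $m$ sits at position $21 - m$. *)
Definition discs_check (xs : seq flt) (l : nat) : bool :=
  all (fun n => disc_check (nth (0, 0, 0) xs (21 - n.-1)) (nth (0, 0, 0) xs (21 - n))
                           (nth (0, 0, 0) xs (21 - n.+1)) n (exceptional n l)) (iota 1 20).

Lemma discs_checkP xs (f : nat -> Z) l n :
    (forall m, (m <= 21)%N -> flt_rel (nth (0, 0, 0) xs (21 - m)) (f m)) ->
    discs_check xs l -> (1 <= n <= 20)%N ->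
  (disc f n <? 0) = exceptional n l.
Proof.
move=> B /allP chk n20; have := chk n; rewrite mem_iota => /(_ n20).
case/andP: n20 => n1 n20; apply: disc_checkP; apply: B => //.
- exact: leq_trans (leq_pred _) (leq_trans n20 _).
- exact: leq_trans n20 _.
Qed.

Definition small_check (p : Z) (al : seq Z) (l : nat) : bool :=
  discs_check (build (0, 0, 0) (1, 0, 0) fadd (fmul p) (fscal p) (fun _ v => v)
                 [seq fnorm p (a, 0, 0) | a <- al] 21) l.

Fixpoint loop (chk : seq Z -> nat -> bool) (al : seq Z) (l fuel : nat) : bool :=
  if fuel is f.+1 then chk al l && loop chk (astep al) l.+1 f else true.

Lemma loopP chk al l0 fuel l : arow_rel l0 al -> loop chk al l0 fuel ->
  (l0 <= l < l0 + fuel)%N -> exists2 al', arow_rel l al' & chk al' l.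
Proof.
elim: fuel al l0 => [|f IH] al l0 ra; first by rewrite addn0; case: ltngtP.
case/andP=> c cl; rewrite leq_eqVlt => /andP[/predU1P[<- _|lt lf]]; first by exists al.
by apply: IH cl _; [exact: astep_rel | rewrite lt addSnnS].
Qed.

Lemma small_checkP p al l n : arow_rel l al -> small_check p al l -> (1 <= n <= 20)%N ->
  (disc (ctZ l) n <? 0) = exceptional n l.
Proof.
move=> [sa H]; rewrite /small_check; set xs := build _ _ _ _ _ _ _ _; apply: discs_checkP.
have [] := @build_rel flt (0, 0, 0) (1, 0, 0) fadd (fmul p) (fscal p) (fun _ v => v) flt_rel
  (flt_rel_exact (Z.le_refl 0)) (flt_rel_exact (Z.le_0_1)) flt_relD (@flt_relM p) (@flt_relZ p) _
  (nsub l) (fun n => #|commuting_tuples l n|) 1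
  (card_commuting0 l) (card_commuting_rec l) [seq fnorm p (a, 0, 0) | a <- al] _ 21 _ => //.
- move=> i; rewrite size_map sa => i21; rewrite (nth_map 0) ?sa // H // Z.pow_1_l; last lia.
  by rewrite Z.mul_1_l; apply: flt_rel_norm; apply: flt_rel_exact; lia.
- by rewrite size_map sa.
rewrite -/xs => _ B m m21; have := B (21 - m)%N (leq_subr _ _).
by rewrite subKn // Z.pow_1_l ?Z.mul_1_l //; lia.
Qed.

Lemma arow_rel0 : arow_rel 0 (1 :: nseq 20 0).
Proof.
by split=> // -[|i] // i21; rewrite -[LHS]/(nth 0 (nseq 20 0) i) nth_nseq if_same.
Qed.

(* For [l = 1] all discriminants vanish, so the computation must be exact. *)
Lemma small_check1 : small_check 100 (astep (1 :: nseq 20 0)) 1.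
Proof. by vm_compute. Qed.

(** The 58 values of [l] from 2 to 59; mantissas of 30 bits separate all the signs. *)
Lemma small_range : loop (small_check 30) (astep (astep (1 :: nseq 20 0))) 2 58.
Proof. by vm_compute. Qed.

Lemma disc_small l n : (1 <= l < 60)%N -> (1 <= n <= 20)%N ->
  (disc (ctZ l) n <? 0) = exceptional n l.
Proof.
have r1 := astep_rel arow_rel0; have r2 := astep_rel r1.
rewrite leq_eqVlt => /andP[/predU1P[<- _|l2 l60]]; first exact: small_checkP r1 small_check1.
move=> n20; have l260 : (2 <= l < 2 + 58)%N by rewrite l2.
by have [al ra c] := loopP r2 small_range l260; apply: small_checkP ra c n20.
Qed.

Lemma Delta_lt0 l n : (0 < n)%N -> (Delta l n < 0)%R = (disc (ctZ l) n <? 0).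
Proof.
case: n => // n _; pose c m := #|commuting_tuples l m|.
have -> : (disc (ctZ l) n.+1 <? 0) = (n.+2 * c n.+1 * c n.+1 < n.+1 * c n * c n.+2)%N.
  rewrite /disc /ctZ -/(c _) -!/(c _) [n.+1.-1]/=.
  by apply/Z.ltb_spec0/ssrnat.ltP; rewrite -!Nat2Z.inj_mul; lia.
rewrite /Delta /Nl -!/(c _) !card_Sn [n.+1.-1]/= !factS -(@ltr_nat rat) !natrM.
set F := (n`!%:R : rat)%R; set a := ((c n)%:R : rat)%R.
set b := ((c n.+1)%:R : rat)%R; set d := ((c n.+2)%:R : rat)%R.
set p := (n.+1%:R : rat)%R; set q := (n.+2%:R : rat)%R.
have F0 : (0 < F)%R by rewrite /F ltr0n fact_gt0.
have p0 : (0 < p)%R by rewrite /p ltr0n.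
have q0 : (0 < q)%R by rewrite /q ltr0n.
clearbody F a b d p q.
have -> : ((b / (p * F)) ^+ 2 - a / F * (d / (q * (p * F))))%R =
          ((q * b * b - p * a * d) / (q * (p * F) ^+ 2))%R.
  by field; rewrite ?lt0r_neq0.
by rewrite pmulr_llt0 ?subr_lt0 // invr_gt0 mulr_gt0 // exprn_gt0 // mulr_gt0.
Qed.

(** * Large [l]: truncated exponential polynomials *)

(** A pair $(b, c)$ stands for the term $c b^l$. Insertion keeps the bases decreasing, the order in
    which [chain] reads them. *)
Definition epoly := seq (positive * Z).

Section Eval.
Variable l : nat.

Definition pw (b : positive) : Z := Z.pos b ^ Z.of_nat l.

Lemma pw_gt0 b : 0 < pw b.
Proof. by apply: Z.pow_pos_nonneg; lia. Qed.

Lemma pwM b b' : pw (b * b') = pw b * pw b'.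
Proof. by rewrite /pw Pos2Z.inj_mul Z.pow_mul_l. Qed.

Definition ev (P : epoly) : Z := foldr (fun bc s => bc.2 * pw bc.1 + s) 0 P.

Fixpoint ins (b : positive) (c : Z) (P : epoly) : epoly :=
  if P is (b', c') :: P' then
    match Pos.compare b b' with
    | Eq => (b, c + c') :: P'
    | Gt => (b, c) :: P
    | Lt => (b', c') :: ins b c P'
    end
  else [:: (b, c)].

Lemma ev_ins b c P : ev (ins b c P) = c * pw b + ev P.
Proof.
elim: P => [|[b' c'] P IH] //=; case: Pos.compare_spec => [->|_|_] //=; last by rewrite IH; lia.
by lia.
Qed.

Definition padd (P Q : epoly) : epoly := foldr (fun bc acc => ins bc.1 bc.2 acc) Q P.

Lemma ev_padd P Q : ev (padd P Q) = ev P + ev Q.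
Proof. by elim: P => [|[b c] P IH] //=; rewrite ev_ins IH; lia. Qed.

Definition pscal (z : Z) (P : epoly) : epoly := [seq (bc.1, z * bc.2) | bc <- P].

Lemma ev_pscal z P : ev (pscal z P) = z * ev P.
Proof. by elim: P => [|[b c] P IH] /=; [lia | rewrite IH; lia]. Qed.

Definition pmul (P Q : epoly) : epoly :=
  foldr (fun bc acc => padd [seq ((bc.1 * x.1)%positive, bc.2 * x.2) | x <- Q] acc) [::] P.

Lemma ev_pmul P Q : ev (pmul P Q) = ev P * ev Q.
Proof.
elim: P => [|[b c] P IH] //=; rewrite ev_padd IH Z.mul_add_distr_r; congr (_ + _).
by elim: Q {IH} => [|[b' c'] Q IH] /=; [lia | rewrite IH pwM; lia].
Qed.

Definition pabs (P : epoly) : epoly := [seq (bc.1, Z.abs bc.2) | bc <- P].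

Lemma ev_pabs P : Z.abs (ev P) <= ev (pabs P).
Proof.
elim: P => [|[b c] P IH] //=; have := pw_gt0 b.
have := Z.abs_triangle (c * pw b) (ev P); rewrite Z.abs_mul; nia.
Qed.

Definition pstep (P : epoly) : epoly := [seq (bc.1, bc.2 * Z.pos bc.1) | bc <- P].

End Eval.

Lemma ev_pstep l P : ev l (pstep P) = ev l.+1 P.
Proof.
elim: P => [|[b c] P IH] //=; rewrite IH /pw Nat2Z.inj_succ Z.pow_succ_r; last lia.
by lia.
Qed.

(* The integer part of [s * log_2 (B / b)]. *)
Definition gain (s : Z) (b B : positive) : Z :=
  let g := Z.gcd (Z.pos b) (Z.pos B) in
  let x := (Z.pos b / g) ^ s in
  let y := (Z.pos B / g) ^ s in
  let q := Z.max 0 (Z.log2 y - Z.log2 x) in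
  if Z.shiftl x q <=? y then q else Z.max 0 (q - 1).

Lemma gain_ge0 s b B : 0 <= gain s b B.
Proof. by rewrite /gain; case: ifP; lia. Qed.

(** The bound $2^k b^s \le B^s$ extends from [s] to every larger exponent because $b \le B$;
    cancelling the gcd only makes the numbers smaller. *)
Lemma gainP s l b B : 0 <= s <= Z.of_nat l -> (b <= B)%positive ->
  2 ^ gain s b B * pw l b <= pw l B.
Proof.
move=> [s0 sl] bB; set k := gain s b B; pose g := Z.gcd (Z.pos b) (Z.pos B).
have g0 : 0 < g.
  by have := Z.gcd_nonneg (Z.pos b) (Z.pos B); have := Z.gcd_eq_0_l (Z.pos b) (Z.pos B); rewrite -/g; lia.
have [b' eb] := Z.gcd_divide_l (Z.pos b) (Z.pos B).
have [B' eB] := Z.gcd_divide_r (Z.pos b) (Z.pos B).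
rewrite -/g in eb eB.
have b'0 : 0 < b' by nia.
have B'0 : 0 < B' by nia.
have le' : b' <= B' by nia.
have db : Z.pos b / g = b' by rewrite eb Z.div_mul //; lia.
have dB : Z.pos B / g = B' by rewrite eB Z.div_mul //; lia.
have k0 : 0 <= k by apply: gain_ge0.
have key : 2 ^ k * b' ^ s <= B' ^ s.
  rewrite /k /gain -/g db dB; set x := b' ^ s; set y := B' ^ s.
  have x0 : 0 < x by apply: Z.pow_pos_nonneg; lia.
  have xy : x <= y by apply: Z.pow_le_mono_l; lia.
  set q := Z.max _ _; case: Z.leb_spec => [|_].
    by rewrite Z.shiftl_mul_pow2; lia.
  case: (Z.le_gt_cases q 0) => hq; first by rewrite Z.max_l; [lia|lia].
  rewrite Z.max_r; last lia.
  (* When the test with [q] fails, $q - 1$ is still safe: $y$ is at least $2^{q-1}$ times the power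
     of two just above $x$. *)
  have [_ lx] := Z.log2_spec x x0.
  have [ly _] := Z.log2_spec y (Z.lt_le_trans _ _ _ x0 xy).
  have e : 2 ^ Z.log2 y = 2 ^ (q - 1) * 2 ^ Z.succ (Z.log2 x).
    by rewrite -Z.pow_add_r; [congr (_ ^ _) | |]; have := Z.log2_nonneg x; lia.
  have := Z.pow_pos_nonneg 2 (q - 1); nia.
rewrite /pw eb eB !Z.pow_mul_l (_ : Z.of_nat l = s + (Z.of_nat l - s)); last lia.
have r0 : 0 <= Z.of_nat l - s by lia.
move: (Z.of_nat l - s) r0 => r r0; rewrite !Z.pow_add_r //.
have h : b' ^ r <= B' ^ r by apply: Z.pow_le_mono_l; lia.
have := Z.pow_pos_nonneg b' r b'0 r0; have := Z.pow_pos_nonneg g r g0 r0.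
have := Z.pow_pos_nonneg g s g0 s0; have := Z.pow_pos_nonneg b' s b'0 s0.
have := Z.pow_pos_nonneg 2 k (Pos2Z.is_pos 2) k0.
move: key h; move: (2 ^ k) (b' ^ s) (B' ^ s) (b' ^ r) (B' ^ r) (g ^ s) (g ^ r) => u x y x' y' z z'.
move=> key h u0 x0 z0 z'0 x'0.
have : u * x * x' <= y * y' by apply: Z.mul_le_mono_nonneg; nia.
have : 0 < z * z' by nia.
by nia.
Qed.

(* [(C, R)] encloses every value at distance at most [ev l R] from [ev l C]. *)
Definition approx := (epoly * epoly)%type.

Definition vadd (v w : approx) : approx := (padd v.1 w.1, padd v.2 w.2).
Definition vscal (z : Z) (v : approx) : approx := (pscal z v.1, pscal (Z.abs z) v.2).
Definition vmul (v w : approx) : approx :=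
  (pmul v.1 w.1,
   padd (pmul (pabs v.1) w.2) (padd (pmul v.2 (pabs w.1)) (pmul v.2 w.2))).

(** The term $c b^l$ becomes an error in base [B]: its coefficient shrinks by the factor 2 to the
    [gain], and the floor plus one rounds it up. *)
Definition absorb (s : Z) (B b : positive) (c : Z) (R : epoly) : epoly :=
  ins B (Z.shiftr (Z.abs c) (gain s b B) + 1) R.

(** Centre terms of base at most [B] and error terms of base below [B] collapse into one error term
    in base [B], which keeps the lists short. *)
Definition trunc (s : Z) (B : positive) (v : approx) : approx :=
  let R0 := foldr (fun bc R => if (bc.1 <? B)%positive then absorb s B bc.1 bc.2 R
                               else ins bc.1 bc.2 R) [::] v.2 in
  foldr (fun bc w => if (B <? bc.1)%positive then (ins bc.1 bc.2 w.1, w.2)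
                     else (w.1, absorb s B bc.1 bc.2 w.2)) ([::], R0) v.1.

Section Approx.
Variables (l : nat) (s : Z) (sl : 0 <= s <= Z.of_nat l).

Definition arel (v : approx) (z : Z) := Z.abs (z - ev l v.1) <= ev l v.2.

Lemma arelD v w y z : arel v y -> arel w z -> arel (vadd v w) (y + z).
Proof. by rewrite /arel !ev_padd; lia. Qed.

Lemma arelZ c v y : arel v y -> arel (vscal c v) (c * y).
Proof.
rewrite /arel !ev_pscal -Z.mul_sub_distr_l Z.abs_mul => h.
by apply: Z.mul_le_mono_nonneg_l => //; lia.
Qed.

Lemma arelM v w y z : arel v y -> arel w z -> arel (vmul v w) (y * z).
Proof.
rewrite /arel /vmul; cbn [fst snd]; rewrite !ev_padd !ev_pmul => h1 h2.
have := @ev_pabs l v.1; have := @ev_pabs l w.1; move: h1 h2.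
move: (ev l v.1) (ev l v.2) (ev l w.1) (ev l w.2) (ev l (pabs v.1)) (ev l (pabs w.1)).
move=> C R C' R' A A' h1 h2 hA' hA.
have -> : y * z - C * C' = (y - C) * (z - C') + ((y - C) * C' + C * (z - C')) by ring.
have := Z.abs_triangle ((y - C) * (z - C')) ((y - C) * C' + C * (z - C')).
have := Z.abs_triangle ((y - C) * C') (C * (z - C')).
rewrite !Z.abs_mul.
have : Z.abs (y - C) * Z.abs (z - C') <= R * R' by apply: Z.mul_le_mono_nonneg; lia.
have : Z.abs (y - C) * Z.abs C' <= R * A' by apply: Z.mul_le_mono_nonneg; lia.
have : Z.abs C * Z.abs (z - C') <= A * R' by apply: Z.mul_le_mono_nonneg; lia.
by lia.
Qed.

Lemma ev_absorb B b c R : (b <= B)%positive -> Z.abs (c * pw l b) + ev l R <= ev l (absorb s B b c R).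
Proof.
move=> bB; rewrite ev_ins Z.abs_mul (Z.abs_eq (pw l b)); last by have := pw_gt0 l b; lia.
have k0 := @gain_ge0 s b B; rewrite Z.shiftr_div_pow2 //.
have := gainP sl bB; have := pw_gt0 l b; have := pw_gt0 l B.
have p0 : 0 < 2 ^ gain s b B by apply: Z.pow_pos_nonneg.
have := Z.div_mod (Z.abs c) (2 ^ gain s b B); have := Z.mod_pos_bound (Z.abs c) _ p0.
move: (2 ^ gain s b B) p0 (Z.abs_nonneg c) => u u0 c0 hm dm B0 b0 h.
have d0 : 0 <= Z.abs c / u by apply: Z.div_pos.
have : Z.abs c <= (Z.abs c / u + 1) * u by nia.
by nia.
Qed.

Lemma arel_trunc B v y : arel v y -> arel (trunc s B v) y.
Proof.
case: v => C R; rewrite /arel /trunc /=; set R0 := foldr _ [::] R.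
have hR : ev l R <= ev l R0.
  rewrite /R0 {R0}; elim: R => [|[b c] R IH] //=; move: IH; set R1 := foldr _ _ R => IH.
  case: Pos.ltb_spec => hb; last by rewrite ev_ins; lia.
  have hb' : (b <= B)%positive by lia.
  by have := @ev_absorb B b c R1 hb'; lia.
move=> h; set W := foldr _ _ C.
(* The error grows at least as much as the centre moves. *)
suff : Z.abs (ev l C - ev l W.1) + ev l R0 <= ev l W.2 by lia.
rewrite /W {W h}; elim: C => [|[b c] C IH] /=; first lia.
move: IH; set W := foldr _ _ C => IH; case: Pos.ltb_spec => hb /=; first by rewrite ev_ins; lia.
by have := @ev_absorb B b c W.2 hb; lia.
Qed.

(** A Horner-like positivity test: the balance [S] in base [B] is worth at least [S] times 2 to the
    [gain] in the next smaller base, where [c] is added. The balance must stay nonnegative and end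
    positive. *)
Fixpoint chain (S : Z) (B : positive) (P : epoly) : bool :=
  if P is (b, c) :: P' then
    (b <? B)%positive && (let S' := Z.shiftl S (gain s b B) + c in (0 <=? S') && chain S' b P')
  else 0 <? S.

Lemma chainP S B P : 0 <= S -> chain S B P -> 0 < S * pw l B + ev l P.
Proof.
elim: P S B => [|[b c] P IH] S B S0 /=; first by move/Z.ltb_lt; have := pw_gt0 l B; nia.
case: Pos.ltb_spec => //= bB /andP[/Z.leb_spec0 S'0 /(IH _ _ S'0)].
rewrite Z.shiftl_mul_pow2; last exact: gain_ge0.
have hb' : (b <= B)%positive by lia.
have := gainP sl hb'; nia.
Qed.

Definition positive_check (P : epoly) : bool :=
  if P is (b, c) :: P' then (0 <=? c) && chain c b P' else false.

Lemma positive_checkP P : positive_check P -> 0 < ev l P.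
Proof. by case: P => // -[b c] P /andP[/Z.leb_spec0 c0 /(chainP c0)]. Qed.

End Approx.

(** * Subgroup counts as exponential polynomials *)

Definition psums (s : seq epoly) : epoly := foldr padd [::] s.

Lemma ev_psums l s : ev l (psums s) = foldr Z.add 0 [seq ev l P | P <- s].
Proof. by elim: s => //= P s IH; rewrite ev_padd IH. Qed.

(** This is $210^k a_0(k)$. *)
Definition unit_coef (k : nat) : Z := if k == 1%N then 210 else 0.

(** The power $210^{k-j}$ brings the stored $210^j a_l(j)$ to the common scale $210^k$. *)
Definition divisor_terms (As : seq epoly) (k : nat) (s : seq nat) : epoly :=
  psums [seq pscal (Z.of_nat j * 210 ^ Z.of_nat (k - j)) (nth [::] As j.-1) | j <- s & (j %| k)%N].

(* The coefficients of [210^m a_l(m)], which are integers for [m <= 21].  Comparing the coefficients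
   of [d^l] in the recurrence for [a] gives the one for [d < m]; that for [d = m] follows from
   [l = 0]. *)
Fixpoint nsub_polys (m : nat) : seq epoly :=
  if m is m'.+1 then
    let As := nsub_polys m' in
    let body := [seq (bc.1, bc.2 / (Z.pos bc.1 - Z.of_nat m)) | bc <- divisor_terms As m (iota 1 m')] in
    rcons As (ins (Pos.of_nat m) (unit_coef m - foldr Z.add 0 [seq bc.2 | bc <- body]) body)
  else [::].

(** The values at [l = 0] and the recurrence are verified coefficient by coefficient, so exactness
    of the divisions in [nsub_polys] needs no separate proof. *)
Definition nsub_polys_check (As : seq epoly) : bool :=
  all (fun k => (foldr Z.add 0 [seq bc.2 | bc <- nth [::] As k.-1] =? unit_coef k) &&
                all (fun bc => bc.2 =? 0)
                    (padd (pstep (nth [::] As k.-1)) (pscal (-1) (divisor_terms As k (iota 1 k)))))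
      (iota 1 21).

Lemma ev0 P : ev 0 P = foldr Z.add 0 [seq bc.2 | bc <- P].
Proof. by elim: P => //= -[b c] P ->; rewrite /pw /=; lia. Qed.

Lemma ev_zero l P : all (fun bc => bc.2 =? 0) P -> ev l P = 0.
Proof. by elim: P => //= -[b c] P IH /= /andP[/Z.eqb_eq -> /IH ->]. Qed.

Lemma nsub_polysP As l k : nsub_polys_check As -> (1 <= k <= 21)%N ->
  210 ^ Z.of_nat k * Z.of_nat (nsub l k) = ev l (nth [::] As k.-1).
Proof.
move=> /allP chk; elim: l k => [|l IH] k k21.
  have := chk k; rewrite mem_iota => /(_ k21) /andP[/Z.eqb_eq + _]; rewrite ev0 => ->.
  by rewrite /unit_coef /=; case: eqP => [->|_] //; rewrite Z.mul_0_r.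
have := chk k; rewrite mem_iota => /(_ k21) /andP[_ /(ev_zero l)].
rewrite ev_padd ev_pstep ev_pscal => e.
have -> : ev l.+1 (nth [::] As k.-1) = ev l (divisor_terms As k (iota 1 k)) by lia.
rewrite ev_psums -map_comp nsub_rec; last by case/andP: k21.
rewrite Z_of_nat_sum.
have : all (fun j => 1 <= j <= k)%N [seq j <- iota 1 k | (j %| k)%N].
  by apply/allP=> j; rewrite mem_filter mem_iota add1n ltnS => /andP[_].
elim: [seq j <- _ | _] => [|j s IHs] /=; first by rewrite Z.mul_0_r.
case/andP=> /andP[j1 jk] /IHs <-; rewrite Z.mul_add_distr_l; congr (_ + _).
rewrite ev_pscal -IH; last by rewrite j1 (leq_trans jk) //; case/andP: k21.
by rewrite Nat2Z.inj_mul -[in LHS](subnK jk) Nat2Z.inj_add Z.pow_add_r; lia.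
Qed.

(* About three quarters of the largest base occurring in the count for [n]. *)
Definition cut (n : nat) : positive :=
  let m := Z.of_nat (n %/ 3) in
  Z.to_pos (3 * nth 0 [:: 3 ^ m; 4 * 3 ^ (m - 1); 2 * 3 ^ m] (n %% 3) / 4).

(** Gains are computed at exponent 60 and so hold for every larger [l]: one run of the recurrence
    serves the whole range. *)
Definition large_seq (As : seq epoly) : seq approx :=
  build ([::], [::]) ([:: (1%positive, 1)], [::]) vadd vmul vscal (fun n => trunc 60 (cut n))
    [seq trunc 60 (cut k) (nth [::] As k.-1, [::]) | k <- iota 1 21] 21.

Definition disc_approx (u v w : approx) (n : nat) : approx :=
  vadd (vscal (Z.of_nat n.+1) (vmul v v)) (vscal (- Z.of_nat n) (vmul u w)).

(** The whole enclosure must lie strictly on one side of zero: centre plus error below it, or centre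
    minus error above it. *)
Definition sign_check (v : approx) (b : bool) : bool :=
  if b then positive_check 60 (pscal (-1) (padd v.1 v.2))
  else positive_check 60 (padd v.1 (pscal (-1) v.2)).

Definition large_check (xs : seq approx) : bool :=
  all (fun n => sign_check
         (disc_approx (nth ([::], [::]) xs (21 - n.-1)) (nth ([::], [::]) xs (21 - n))
                      (nth ([::], [::]) xs (21 - n.+1)) n) (exceptional n 60)) (iota 1 20).

Lemma large_checkP l xs (f : nat -> Z) n : (60 <= l)%N ->
    (forall m, (m <= 21)%N -> arel l (nth ([::], [::]) xs (21 - m)) (f m)) ->
    large_check xs -> (1 <= n <= 20)%N ->
  (disc f n <? 0) = exceptional n 60.
Proof.
move=> l60 B /allP chk n20; have := chk n; rewrite mem_iota => /(_ n20).
have n21 : (n <= 21)%N by case/andP: n20 => _ n20; apply: leq_trans n20 _.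
have n1 : (n.-1 <= 21)%N by apply: leq_trans (leq_pred _) n21.
have n2 : (n.+1 <= 21)%N by case/andP: n20.
have s60 : 0 <= 60 <= Z.of_nat l by move/ssrnat.leP: l60; lia.
set v := disc_approx _ _ _ _; have : arel l v (disc f n).
  have -> : disc f n = Z.of_nat n.+1 * (f n * f n) + - Z.of_nat n * (f n.-1 * f n.+1).
    by rewrite /disc; lia.
  by apply: arelD; apply: arelZ; apply: arelM; apply: B.
rewrite /arel /sign_check => h; case: exceptional => /(positive_checkP s60).
  by rewrite ev_pscal ev_padd => pos; apply/Z.ltb_lt; lia.
by rewrite ev_padd ev_pscal => pos; apply/Z.ltb_ge; lia.
Qed.

Lemma nsub_polys_ok : nsub_polys_check (nsub_polys 21).
Proof. by vm_compute. Qed.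

Lemma large_ok : large_check (large_seq (nsub_polys 21)).
Proof. by vm_compute. Qed.

(** In both products of [disc] the indices add up to $2n$, so the scaling factors out and leaves the
    sign unchanged. *)
Lemma disc_scale (f : nat -> Z) n : (0 < n)%N ->
  disc (fun m => 210 ^ Z.of_nat m * f m) n = 210 ^ Z.of_nat (2 * n) * disc f n.
Proof.
case: n => // n _; rewrite /disc [n.+1.-1]/=.
have p m : 210 ^ Z.of_nat m.+1 = 210 * 210 ^ Z.of_nat m.
  by rewrite Nat2Z.inj_succ Z.pow_succ_r //; lia.
have -> : 210 ^ Z.of_nat (2 * n.+1) = 210 ^ Z.of_nat n.+1 * 210 ^ Z.of_nat n.+1.
  by rewrite mul2n -addnn Nat2Z.inj_add Z.pow_add_r //; lia.
by rewrite !p; ring.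
Qed.

Lemma disc_large l n : (60 <= l)%N -> (1 <= n <= 20)%N ->
  (disc (ctZ l) n <? 0) = exceptional n 60.
Proof.
move=> l60 n20; have s60 : 0 <= 60 <= Z.of_nat l by move/ssrnat.leP: l60; lia.
have n0 : (0 < n)%N by case/andP: n20.
have -> : (disc (ctZ l) n <? 0) = (disc (fun m => 210 ^ Z.of_nat m * ctZ l m) n <? 0).
  rewrite disc_scale //; have : 0 < 210 ^ Z.of_nat (2 * n) by apply: Z.pow_pos_nonneg; lia.
  by move=> h; apply/Z.ltb_spec0/Z.ltb_spec0; nia.
apply: (large_checkP l60 _ large_ok n20).
rewrite /large_seq; have := nsub_polys_ok; move: (nsub_polys 21) => As ok.
set al := [seq _ | k <- iota 1 21].
have sa : size al = 21%N by rewrite size_map size_iota.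
have [] := @build_rel approx ([::], [::]) ([:: (1%positive, 1)], [::]) vadd vmul vscal
  (fun n => trunc 60 (cut n)) (arel l) _ _ (@arelD l) (@arelM l) _ (fun k => @arel_trunc l 60 s60 (cut k))
  (nsub l) (fun n => #|commuting_tuples l n|) 210
  (card_commuting0 l) (card_commuting_rec l) al _ 21 _.
- by [].
- have p1 : pw l 1 = 1 by rewrite /pw Z.pow_1_l; lia.
  by rewrite /arel /ev; cbn [foldr fst snd]; rewrite p1.
- by move=> c v y; apply: arelZ.
- move=> i; rewrite sa => i21; rewrite (nth_map 0%N) ?size_iota // nth_iota // add1n.
  by apply: arel_trunc => //; rewrite /arel (nsub_polysP l ok) //= Z.sub_diag.
- by rewrite sa.
move=> _ B m m21; have := B (21 - m)%N (leq_subr _ _).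
by rewrite subKn.
Qed.

(** * Joining the two ranges of [l] *)

Lemma exceptional_large n l : (60 <= l)%N -> (1 <= n <= 20)%N -> exceptional n l = exceptional n 60.
Proof.
move=> l60 /andP[_ n20].
(* Every threshold in the list is below 60, the largest being 54, so each comparison has the same
   outcome for [l] as for 60. *)
have le k : (k <= 60)%N -> (k <= l)%N by move=> h; apply: leq_trans h l60.
have gt k : (k < 60)%N -> (l <= k)%N = false.
  by move=> h; apply/negbTE; rewrite -ltnNge; apply: leq_trans h l60.
by rewrite /exceptional !le // !gt //.
Qed.

Lemma disc_exceptional l n : (1 <= l)%N -> (1 <= n <= 20)%N ->
  (disc (ctZ l) n <? 0) = exceptional n l.
Proof.
move=> l1 n20; case: (ltnP l 60) => l60; first by apply: disc_small; rewrite ?l1.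
by rewrite disc_large // exceptional_large.
Qed.

Local Close Scope Z_scope.

Theorem theorem1p4 (n l : nat) :
  (1 <= n <= 20)%N -> (1 <= l)%N ->
  ((Delta l n < 0)%R <->
     [|| (n == 1) && (2 <= l),
         (n == 3) && (2 <= l <= 13),
         (n == 4) && (16 <= l),
         (n == 5) && (2 <= l <= 19),
         (n == 7) && (2 <= l),
         (n == 8) && (15 <= l <= 26),
         (n == 9) && (2 <= l <= 12),
         (n == 10) && (22 <= l),
         (n == 11) && (2 <= l <= 35),
         (n == 13) && ((2 <= l <= 9) || (26 <= l)),
         (n == 14) && (20 <= l <= 44),
         (n == 15) && (2 <= l <= 8),
         (n == 16) && (29 <= l),
         (n == 17) && ((2 <= l <= 6) || (24 <= l <= 54)),
         (n == 19) && ((2 <= l <= 4) || (32 <= l)) |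
         (n == 20) && (27 <= l)])%N.
Proof.
move=> n20 l1; rewrite -/(exceptional n l) Delta_lt0; last by case/andP: n20.
by rewrite disc_exceptional.
Qed.
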